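(* In the setting described in the context, assume that: (i) (coercivity condition for $V_h\times\Lambda_h$) for all $u_h\in V_h$ there exists $\xi_h(u_h)\in\Lambda_h$ such that $$\alpha_\xi\|u_h\|_{V_h}^2 \le a(u_h,u_h)+b(\xi_h(u_h),u_h),\qquad s(\xi_h(u_h),\xi_h(u_h))^{\frac12}\le c_s\|u_h\|_{V_h},$$ where $\alpha_\xi,c_s$ are positive constants independent of $h$ and $c_s$ can be made small by choosing the stabilisation parameter (the constant scaling $s$) small; (ii) there exists a space $L_h$ such that the pair $V_h\times L_h$ satisfies, uniformly in $h$, the discrete inf-sup condition $$\|\mu_h\|_{L} \lesssim \sup_{v_h\in V_h} \frac{b(\mu_h,v_h)}{\|v_h\|_V}\qquad \forall \mu_h\in L_h.$$ Then the stabilised problem: find $(u_h,\lambda_h)\in V_h\times\Lambda_h$ such that $$a(u_h,v_h)+b(\lambda_h,v_h)+b(\mu_h,u_h)-s(\lambda_h,\mu_h)=(f,v_h)\qquad \forall (v_h,\mu_h)\in V_h\times\Lambda_h,$$ admits a unique solution $\{u_h,\lambda_h\}$. This solution satisfies the best approximation property $$\|u-u_h\|_V+\|\lambda-\lambda_h\|_L \lesssim \inf_{y_h\in V_h}\|u-y_h\|_V+\inf_{\nu_h\in\Lambda_h}\left(\|\lambda-\nu_h\|_L+s(\nu_h,\nu_h)^{\frac12}\right),$$ where $(u,\lambda)\in V\times L$ is the solution of the continuous problem $a(u,v)+b(\lambda,v)+b(\mu,u)=(f,v)$ for all $(v,\mu)\in V\times L$.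
   Context: Notation: $x\lesssim y$ means $x\le Cy$ with a constant $C$ independent of the mesh size $h$ (but not necessarily of the local mesh geometry). All meshes are assumed quasi-uniform and shape regular. Continuous setting. $V$ and $L$ are spaces with norms $\|\cdot\|_V$, $\|\cdot\|_L$, and $a:V\times V\to\mathbb{R}$, $b:L\times V\to\mathbb{R}$ are bilinear forms, representing a partial differential operator in weak form and a constraint respectively; $(f,v)$ denotes the given right-hand side, linear in $v$. The spaces $V$ and $L$ are chosen such that the continuous problem (find $(u,\lambda)\in V\times L$ with $a(u,v)+b(\lambda,v)+b(\mu,u)=(f,v)$ for all $(v,\mu)\in V\times L$) is well posed, and it is assumed that - $a(u,v)\lesssim\|u\|_V\|v\|_V$ for all $u,v\in V$, and $b(\lambda,v)\lesssim\|\lambda\|_L\|v\|_V$ for all $\lambda\in L$, $v\in V$; - $\|v\|_V^2\lesssim a(v,v)$ for all $v\in V$ such that $b(\mu,v)=0$ for all $\mu\in L$; - $\|\lambda\|_L\lesssim\sup_{v\in V} b(\lambda,v)/\|v\|_V$ for all $\lambda\in L$. Discrete setting. $V_h\subset V$, $L_h\subset L$ and $\Lambda_h\subset L$ are discrete (finite element) spaces; $\Lambda_h$ is the multiplier space used in the method, possibly unrelated to and richer than $L_h$, and no inf-sup stability is assumed for $V_h\times\Lambda_h$. $\|\cdot\|_{V_h}$ and $\|\cdot\|_{L_h}$ are norms defined on functions in the discrete spaces (the latter on discrete multipliers, including differences of elements of $\Lambda_h$ and $L_h$), such that - $a(u_h,v_h)\le\|u_h\|_{V_h}\|v_h\|_{V_h}$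 for all $u_h,v_h\in V_h$, and $b(\lambda_h,v_h)\le\|\lambda_h\|_{L_h}\|v_h\|_{V_h}$ for all $\lambda_h\in L_h$, $v_h\in V_h$; - $\|v_h\|_V\lesssim\|v_h\|_{V_h}$ for all $v_h\in V_h$. There exists a projection $\pi_L:\Lambda_h\to L_h$ such that $$b(\lambda_h-\pi_L\lambda_h,v)\lesssim\|\lambda_h-\pi_L\lambda_h\|_{L_h}\|v\|_V\qquad\forall\lambda_h\in\Lambda_h,\ \forall v\in V.$$ The stabilisation $s(\cdot,\cdot)$ is a symmetric bilinear form on $\Lambda_h\times\Lambda_h$ designed so that $$\|\lambda_h-\pi_L\lambda_h\|_{L_h}^2\lesssim s(\lambda_h,\lambda_h)\qquad\forall\lambda_h\in\Lambda_h.$$ *)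

(* Defs.v *)
From HB Require Import structures.
From mathcomp Require Export all_boot all_order all_algebra.
From mathcomp Require Export all_classical all_reals all_analysis.
Export Order.TTheory GRing.Theory Num.Theory.
Export numFieldNormedType.Exports.

Set Implicit Arguments.
Unset Strict Implicit.
Unset Printing Implicit Defensive.

Local Open Scope classical_set_scope.
Local Open Scope ring_scope.

(* The discrete spaces are finite-dimensional subspaces of the (in general
   infinite-dimensional) spaces V and L.  They are encoded as sets, and objects
   that only live on a discrete space (discrete norms, stabilisation,
   projection) as total functions constrained on that set only. *)

Definition findim_subspace (R : realType) (V : lmodType R) (A : set V) : Prop :=
  exists n (e : 'I_n -> V), A = range (fun c : 'I_n -> R => \sum_i c i *: e i).

Definition norm_on (R : realType) (V : lmodType R) (A : set V) (N : V -> R) :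
    Prop :=
  [/\ forall x, A x -> 0 <= N x,
      forall x, A x -> N x = 0 -> x = 0,
      forall c x, A x -> N (c *: x) = `|c| * N x &
      forall x y, A x -> A y -> N (x + y) <= N x + N y].

Definition linear_on (R : realType) (V W : lmodType R) (A : set V)
    (f : V -> W) : Prop :=
  forall c x y, A x -> A y -> f (c *: x + y) = c *: f x + f y.

Definition symmetric_bilinear_on (R : realType) (V : lmodType R) (A : set V)
    (s : V -> V -> R) : Prop :=
  (forall x, A x -> linear_on A (s x : V -> R^o)) /\
  (forall x y, A x -> A y -> s x y = s y x).

(* B need not be contained in A: idempotency is the requirement that elements
   of A already lying in B are left unchanged, which is the usual one when
   B `<=` A. *)
Definition projection_onto (R : realType) (V : lmodType R) (A B : set V)
    (p : V -> V) : Prop :=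
  [/\ linear_on A p, forall x, A x -> B (p x) &
      forall x, A x -> B x -> p x = x].

(* The supremum is that of a bounded set as soon as b is continuous; it is 0 on
   the trivial space. *)
Definition sup_quotient (R : realType) (V L : normedModType R)
    (b : L -> V -> R) (A : set V) (l : L) : R :=
  sup [set b l v / `|v| | v in A `\ 0].

Definition continuous_solution (R : realType) (V L : normedModType R)
    (a : V -> V -> R) (b : L -> V -> R) (f : V -> R) (q : V * L) : Prop :=
  forall v m, a q.1 v + b q.2 v + b m q.1 = f v.

Definition stabilised_solution (R : realType) (V L : normedModType R)
    (a : V -> V -> R) (b : L -> V -> R) (f : V -> R)
    (A : set V) (B : set L) (s : L -> L -> R) (p : V * L) : Prop :=
  [/\ A p.1, B p.2 &
      forall v m, A v -> B m ->
        a p.1 v + b p.2 v + b m p.1 - s p.2 m = f v].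

(* The stabilisation with stabilisation parameter g. *)
Definition stab (R : realType) (L : Type) (g : R) (s : L -> L -> R) (x y : L) :
    R := g * s x y.

(* Main.v *)
Require Import Defs.
From mathcomp Require Import ring lra.

Set Implicit Arguments.
Unset Strict Implicit.
Unset Printing Implicit Defensive.

Local Open Scope classical_set_scope.
Local Open Scope ring_scope.

(* Testing the stabilised form at (e, -eta) and at (0, xi(e)) controls
   |e|_(V_h)^2 + s(eta, eta) as soon as c_s^2 <= alpha_xi.  The multiplier norm
   is recovered by splitting eta = pi eta + (eta - pi eta): the first part is
   bounded by the discrete inf-sup condition, the second one by the continuous
   inf-sup condition and s.  Since |xi(e)|_L is not controlled by e, the
   consistency term b(mu, u - y) may only be bounded by s(mu, mu)^(1/2); this
   holds when b(m, u - y) = 0 for all m in L_h, and the inf-sup condition on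
   V_h x L_h with Hahn-Banach provides a quasi-optimal such y. *)

(** * Finite-dimensional subspaces and maps linear on them *)

Lemma range_lincomb_gen (R : realType) (V : lmodType R) n (e : 'I_n -> V) i :
  range (fun c : 'I_n -> R => \sum_i c i *: e i) (e i).
Proof.
exists (fun j => (j == i)%:R) => //.
rewrite (bigD1 i)//= eqxx scale1r big1 ?addr0// => j /negPf ->.
by rewrite scale0r.
Qed.

Lemma findim_subspace0 (R : realType) (V : lmodType R) (A : set V) :
  findim_subspace A -> A 0.
Proof.
move=> [n [e ->]]; exists (fun=> 0) => //.
by rewrite big1// => i _; rewrite scale0r.
Qed.

Lemma findim_subspaceP (R : realType) (V : lmodType R) (A : set V) c x y :
  findim_subspace A -> A x -> A y -> A (c *: x + y).
Proof.
move=> [n [e ->]] [f _ <-] [g _ <-]; exists (fun i => c * f i + g i) => //.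
rewrite scaler_sumr -big_split; apply: eq_bigr => i _ /=.
by rewrite scalerDl scalerA.
Qed.

Lemma findim_subspaceD (R : realType) (V : lmodType R) (A : set V) x y :
  findim_subspace A -> A x -> A y -> A (x + y).
Proof. by move=> fA Ax Ay; rewrite -[x]scale1r; exact: findim_subspaceP. Qed.

Lemma findim_subspaceZ (R : realType) (V : lmodType R) (A : set V) c x :
  findim_subspace A -> A x -> A (c *: x).
Proof.
move=> fA Ax; rewrite -[_ *: _]addr0.
by apply: findim_subspaceP => //; exact: findim_subspace0.
Qed.

Lemma findim_subspaceN (R : realType) (V : lmodType R) (A : set V) x :
  findim_subspace A -> A x -> A (- x).
Proof. by move=> fA Ax; rewrite -scaleN1r; exact: findim_subspaceZ. Qed.

Lemma findim_subspaceB (R : realType) (V : lmodType R) (A : set V) x y :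
  findim_subspace A -> A x -> A y -> A (x - y).
Proof.
by move=> fA Ax Ay; apply: findim_subspaceD => //; exact: findim_subspaceN.
Qed.

Lemma findim_subspaceX (R : realType) (V W : lmodType R) (A : set V)
    (B : set W) :
  findim_subspace A -> findim_subspace B -> findim_subspace (A `*` B).
Proof.
move=> [m [e ->]] [n [e' ->]].
exists (m + n)%N, (fun k => match fintype.split k with
  | inl i => (e i, 0) | inr j => (0, e' j) end).
have sumE (c : 'I_(m + n) -> R) :
    \sum_k c k *: match fintype.split k with
      | inl i => (e i, 0 : W) | inr j => (0, e' j) end =
    (\sum_i c (lshift n i) *: e i, \sum_j c (rshift m j) *: e' j).
  rewrite big_split_ord /= [RHS]surjective_pairing /=.
  have -> : \sum_i c (lshift n i) *: match fintype.split (lshift n i) with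
      | inl i => (e i, 0 : W) | inr j => (0, e' j) end =
      (\sum_i c (lshift n i) *: e i, 0).
    elim/big_ind2: _ => //= [x1 x2 y1 y2 -> ->|i _].
      by congr pair; rewrite /= addr0.
    by rewrite (unsplitK (inl i)); congr pair; rewrite /= scaler0.
  have -> : \sum_j c (rshift m j) *: match fintype.split (rshift m j) with
      | inl i => (e i, 0 : W) | inr j => (0, e' j) end =
      (0, \sum_j c (rshift m j) *: e' j).
    elim/big_ind2: _ => //= [x1 x2 y1 y2 -> ->|i _].
      by congr pair; rewrite /= addr0.
    by rewrite (unsplitK (inr i)); congr pair; rewrite /= scaler0.
  by congr pair; rewrite /= ?addr0 ?add0r.
apply/seteqP; split => [[x y] /= [[c _ <-] [d _ <-]]|_ [c _ <-]]; last first.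
  by rewrite sumE; split; [exists (c \o lshift n)|exists (c \o @rshift m n)].
exists (fun k => match fintype.split k with
  | inl i => c i | inr j => d j end) => //.
rewrite sumE; congr pair; apply: eq_bigr => i _.
  by rewrite (unsplitK (inl i)).
by rewrite (unsplitK (inr i)).
Qed.

Section linear_on.
Variables (R : realType) (W : lmodType R) (A : set W) (q : W -> R^o).
Hypotheses (fA : findim_subspace A) (ql : linear_on A q).

Lemma linear_on0 : q 0 = 0.
Proof.
have A0 := findim_subspace0 fA.
have := ql 1 A0 A0; rewrite !scale1r addr0 => /eqP.
by rewrite -subr_eq subrr eq_sym => /eqP.
Qed.

Lemma linear_onD x y : A x -> A y -> q (x + y) = q x + q y.
Proof. by move=> Ax Ay; have := ql 1 Ax Ay; rewrite !scale1r. Qed.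

Lemma linear_onZ c x : A x -> q (c *: x) = c * q x.
Proof.
move=> Ax; have := ql c Ax (findim_subspace0 fA).
by rewrite linear_on0 !addr0.
Qed.

Lemma linear_onN x : A x -> q (- x) = - q x.
Proof. by move=> Ax; rewrite -scaleN1r linear_onZ// mulN1r. Qed.

Lemma linear_onB x y : A x -> A y -> q (x - y) = q x - q y.
Proof.
move=> Ax Ay; rewrite linear_onD ?linear_onN//; exact: findim_subspaceN.
Qed.

End linear_on.

Lemma linear_on_sum (R : realType) (V : lmodType R) (A : set V)
    (f : V -> R^o) n (e : 'I_n -> V) (c : 'I_n -> R) :
  A = range (fun c : 'I_n -> R => \sum_i c i *: e i) -> linear_on A f ->
  f (\sum_i c i *: e i) = \sum_i c i * f (e i).
Proof.
move=> AE fl; have fA : findim_subspace A by exists n, e.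
have Ae i : A (e i) by rewrite AE; exact: range_lincomb_gen.
(* Membership in [A] is carried through the induction, since [f] is linear only there. *)
suff [] : A (\sum_i c i *: e i) /\
  f (\sum_i c i *: e i) = \sum_i c i * f (e i) by [].
elim/big_rec2: _ => [|i x y _ [Ay <-]].
  by split; [exact: findim_subspace0|exact: (linear_on0 fA fl)].
split; last exact: fl.
exact: findim_subspaceP.
Qed.

(** Fredholm alternative, read off the matrix [M] of [c] on generators: a row lies in the row space
    of [M] once it kills the columns of the cokernel of [M]. Such a column [d] yields an element of
    [B] on which every [c x] vanishes, which is where the annihilator hypothesis applies. *)
Lemma findim_solve (R : realType) (V W : lmodType R) (A : set V) (B : set W)
    (c : V -> W -> R) (F : W -> R) :
  findim_subspace A -> findim_subspace B ->
  (forall y, B y -> linear_on A (c^~ y : V -> R^o)) ->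
  (forall x, A x -> linear_on B (c x : W -> R^o)) ->
  linear_on B (F : W -> R^o) ->
  (forall y, B y -> (forall x, A x -> c x y = 0) -> F y = 0) ->
  exists2 x, A x & forall y, B y -> c x y = F y.
Proof.
move=> fA fB; have [m [e AE]] := fA; have [n [e' BE]] := fB.
move=> cl cr Fl ann.
have Ae i : A (e i) by rewrite AE; exact: range_lincomb_gen.
have BS (d : 'I_n -> R) : B (\sum_i d i *: e' i) by rewrite BE; exists d.
have AS (d : 'I_m -> R) : A (\sum_i d i *: e i) by rewrite AE; exists d.
pose M : 'M[R]_(m, n) := \matrix_(i, j) c (e i) (e' j).
pose G : 'rV[R]_n := \row_j F (e' j).
have : (G <= M)%MS.
  rewrite submxE; apply/eqP/matrixP => i k; rewrite !mxE ord1.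
  pose d j := cokermx M j k.
  have := ann (\sum_j d j *: e' j) (BS d).
  rewrite (linear_on_sum _ BE Fl) => Fd.
  transitivity (\sum_i0 d i0 * F (e' i0)).
    by apply: eq_bigr => j _; rewrite mxE mulrC.
  apply: Fd => x; rewrite AE => -[d' _ <-].
  rewrite (linear_on_sum _ AE (cl _ (BS _))) big1// => i' _.
  rewrite (linear_on_sum _ BE (cr _ (Ae i'))).
  have /matrixP/(_ i' k) := mulmx_coker M; rewrite !mxE => Mk.
  rewrite (_ : \sum_i0 _ = 0) ?mulr0// -[RHS]Mk.
  by apply: eq_bigr => j _; rewrite mxE mulrC.
move=> /submxP[D GD]; exists (\sum_i D 0 i *: e i) => // y.
rewrite BE => -[d _ <-].
rewrite (linear_on_sum _ BE Fl) (linear_on_sum _ BE (cr _ (AS _))).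
apply: eq_bigr => j _; congr (_ * _).
have /matrixP/(_ 0 j) := GD; rewrite !mxE => ->.
rewrite (linear_on_sum _ AE (cl _ _)); last first.
  by rewrite BE; exact: range_lincomb_gen.
by apply: eq_bigr => i _; rewrite mxE.
Qed.

(** * Sublinear functions and Hahn-Banach on a finite-dimensional subspace *)

Definition sublinear (R : realType) (V : lmodType R) (p : V -> R) : Prop :=
  (forall x y, p (x + y) <= p x + p y) /\
  (forall t x, 0 <= t -> p (t *: x) <= t * p x).

Section sublinear_lemmas.
Variables (R : realType) (V : lmodType R).
Implicit Types (p : V -> R) (x v : V).

Lemma sublinear0 p : sublinear p -> p 0 = 0.
Proof.
move=> [pD pZ]; apply/eqP; rewrite eq_le; apply/andP; split.
  by have := pZ 0 0 (lexx _); rewrite scale0r mul0r.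
by have := pD 0 0; rewrite addr0; lra.
Qed.

Lemma sublinearZ p t x : sublinear p -> 0 <= t -> p (t *: x) = t * p x.
Proof.
move=> sp; rewrite le_eqVlt => /predU1P[<-|t0].
  by rewrite scale0r mul0r sublinear0.
have [pD pZ] := sp; apply/eqP; rewrite eq_le pZ ?(ltW t0)//=.
have := pZ t^-1 (t *: x); rewrite invr_ge0 (ltW t0) => /(_ isT).
by rewrite scalerA mulVf ?gt_eqF// scale1r mulrC ler_pdivlMr// mulrC.
Qed.

Lemma sublinear_geN p x : sublinear p -> - p (- x) <= p x.
Proof.
by move=> sp; have [+ _] := sp => /(_ x (- x)); rewrite subrr sublinear0//; lra.
Qed.

Lemma sublinear_add_lineal p x v : sublinear p -> p (- v) = - p v ->
  p (x + v) = p x + p v.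
Proof.
move=> [pD _] pv; apply/eqP; rewrite eq_le pD/=.
by have := pD (x + v) (- v); rewrite addrK pv; lra.
Qed.

(* The largest sublinear function below [p] that is at most [- p v] at [- v],
   hence additive in the direction [v]. *)
Definition sublinear_along p v x : R :=
  inf [set p (x + t *: v) - t * p v | t in [set t | 0 <= t]].

Lemma sublinear_along_le p v x t : sublinear p -> 0 <= t ->
  sublinear_along p v x <= p (x + t *: v) - t * p v.
Proof.
move=> sp t0; apply: ge_inf; last by exists t.
(* A lower bound independent of [r]: by subadditivity, p (r v) <= p (x + r v) + p (- x). *)
exists (- p (- x)) => _ [r /= r0 <-].
rewrite -sublinearZ//; have [+ _] := sp => /(_ (x + r *: v) (- x)).
by rewrite addrAC subrr add0r; lra.
Qed.

Lemma le_sublinear_along p v x c :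
  (forall t, 0 <= t -> c <= p (x + t *: v) - t * p v) ->
  c <= sublinear_along p v x.
Proof.
move=> H; apply: lb_le_inf; first by exists (p (x + 0 *: v) - 0 * p v), 0 => /=.
by move=> _ [t t0 <-]; exact: H.
Qed.

Lemma sublinear_along_leW p v x : sublinear p -> sublinear_along p v x <= p x.
Proof.
move=> sp; have := @sublinear_along_le p v x 0 sp (lexx _).
by rewrite scale0r addr0 mul0r subr0.
Qed.

Lemma sublinear_along_sublinear p v :
  sublinear p -> sublinear (sublinear_along p v).
Proof.
move=> sp; have [pD _] := sp; split=> [x y|t x].
  rewrite -lerBlDr; apply: le_sublinear_along => r r0.
  rewrite lerBlDr -lerBlDl; apply: le_sublinear_along => q q0.
  rewrite lerBlDl.
  apply: (le_trans (sublinear_along_le _ _ sp (addr_ge0 r0 q0))).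
  have := pD (x + r *: v) (y + q *: v).
  by rewrite addrACA -scalerDl mulrDl; lra.
rewrite le_eqVlt => /predU1P[<-|t0].
  rewrite scale0r mul0r; apply: (le_trans (sublinear_along_leW _ _ sp)).
  by rewrite sublinear0.
rewrite mulrC -ler_pdivrMr//; apply: le_sublinear_along => r r0.
rewrite ler_pdivrMr//.
apply: (le_trans (sublinear_along_le _ _ sp (mulr_ge0 (ltW t0) r0))).
by rewrite -scalerA -scalerDr sublinearZ ?(ltW t0)//; lra.
Qed.

(** Linearity in a direction survives further lowering: p v = - p (- v) <= - q (- v) <= q v <= p v,
    so all are equal. *)
Lemma sublinear_below_lineal p q v : sublinear p -> sublinear q ->
  (forall x, q x <= p x) -> p (- v) = - p v -> q v = p v /\ q (- v) = - q v.
Proof.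
move=> sp sq qp pv; have := sublinear_geN v sq; have := qp v; have := qp (- v).
by rewrite pv => h1 h2 h3; split; lra.
Qed.

(** The parameter t = 1 at [- v] bounds the lowered function there by [- p v]; the chain p v <= - q
    (- v) <= q v <= p v then closes, with [q] the lowered function. *)
Lemma sublinear_alongN p v : sublinear p ->
  sublinear_along p v v = p v /\
  sublinear_along p v (- v) = - sublinear_along p v v.
Proof.
move=> sp; have sq := sublinear_along_sublinear v sp.
have := @sublinear_along_le p v (- v) 1 sp ler01.
rewrite scale1r addNr mul1r sublinear0// sub0r => h1.
have h2 := sublinear_along_leW v v sp.
have h3 := sublinear_geN v sq.
by split; lra.
Qed.

(** Lower along one vector after another; what has been made linear stays so by
    [sublinear_below_lineal]. *)
Lemma sublinear_lineal_seq p (r : seq V) : sublinear p -> exists2 q,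
  sublinear q & (forall x, q x <= p x) /\ {in r, forall v, q (- v) = - q v}.
Proof.
elim: r p => [|v r IH] p sp; first by exists p.
have [q sq [qp qr]] := IH _ (sublinear_along_sublinear v sp).
exists q => //; split=> [x|w].
  exact: le_trans (qp x) (sublinear_along_leW _ _ sp).
rewrite inE => /predU1P[->|]; last exact: qr.
by have [_ ->] := sublinear_below_lineal (sublinear_along_sublinear v sp) sq qp
  (sublinear_alongN v sp).2.
Qed.

Lemma sublinear_linear_on p (A : set V) n (e : 'I_n -> V) :
  A = range (fun c : 'I_n -> R => \sum_i c i *: e i) -> sublinear p ->
  (forall i, p (- e i) = - p (e i)) -> linear_on A (p : V -> R^o).
Proof.
move=> AE sp pe.
have pZe t i : p (t *: e i) = t * p (e i).
  have [t0|t0] := leP 0 t; first exact: sublinearZ.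
  rewrite -[t]opprK scaleNr -scalerN sublinearZ// ?pe; last first.
    by rewrite oppr_ge0 ltW.
  by rewrite mulrN -mulNr.
have psum (c : 'I_n -> R) : p (\sum_i c i *: e i) = \sum_i c i * p (e i).
  elim/big_rec2: _ => [|i x y _ <-]; first exact: sublinear0.
  rewrite addrC sublinear_add_lineal// ?pZe 1?addrC//.
  by rewrite -scaleNr pZe mulNr.
move=> t x y; rewrite AE => -[c _ <-] [d _ <-].
rewrite scaler_sumr -big_split/= !psum.
under eq_bigr do rewrite scalerA -scalerDl.
rewrite psum scaler_sumr -big_split/=; apply: eq_bigr => i _.
by rewrite mulrDl [in RHS]/GRing.scale/= mulrA.
Qed.

(** Lowering along [w] first freezes the value [p w]; lowering along the generators of [A] then
    gives linearity on [A] without disturbing it. *)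
Lemma hahn_banach_findim p (A : set V) w : sublinear p -> findim_subspace A ->
  A w -> exists q : V -> R,
  [/\ linear_on A (q : V -> R^o), forall x, A x -> q x <= p x & q w = p w].
Proof.
move=> sp [n [e AE]] Aw.
have [q sq [qp qr]] :=
  sublinear_lineal_seq [seq e i | i : 'I_n] (sublinear_along_sublinear w sp).
exists q; split.
- apply: (sublinear_linear_on AE sq) => i.
  by apply: qr; exact: map_f (mem_enum _ _).
- by move=> x _; apply: le_trans (qp x) _; exact: sublinear_along_leW.
have [e1 e2] := sublinear_alongN w sp.
have [-> _] := sublinear_below_lineal (sublinear_along_sublinear w sp) sq qp e2.
exact: e1.
Qed.

End sublinear_lemmas.

(** * Inf-sup conditions and a Fortin-type correction *)

Lemma sup_quotient_le (R : realType) (V L : normedModType R)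
    (b : L -> V -> R) (A : set V) (l : L) (t : R) :
  0 <= t -> (forall v, A v -> b l v <= t * `|v|) -> sup_quotient b A l <= t.
Proof.
move=> t0 bt; rewrite /sup_quotient.
(* On the trivial space the supremum is over the empty set and equals 0, hence the assumption
   [0 <= t]. *)
have [->|/set0P AN0] := eqVneq (A `\ 0) set0; first by rewrite image_set0 sup0.
apply: ge_sup; first exact: image_nonempty.
move=> _ [v [Av /eqP v0] <-]; rewrite ler_pdivrMr ?normr_gt0//; exact: bt.
Qed.

Lemma dist_subspace_sublinear (R : realType) (V : normedModType R) (K : set V) :
  K 0 -> (forall x y, K x -> K y -> K (x + y)) ->
  (forall c x, K x -> K (c *: x)) ->
  sublinear (fun v => inf [set `|v + k| | k in K]).
Proof.
move=> K0 KD KZ.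
have le_dist v k : K k -> inf [set `|v + k| | k in K] <= `|v + k|.
  by move=> Kk; apply: ge_inf; [exists 0 => _ [? _ <-]|exists k].
have dist_ge c v : (forall k, K k -> c <= `|v + k|) ->
    c <= inf [set `|v + k| | k in K].
  move=> H; apply: lb_le_inf; first by exists `|v + 0|, 0.
  by move=> _ [k Kk <-]; exact: H.
split=> [x y|t x].
  rewrite -lerBlDr; apply: (dist_ge) => k Kk; rewrite lerBlDr -lerBlDl.
  apply: (dist_ge) => k' Kk'; rewrite lerBlDl.
  apply: le_trans (le_dist _ _ (KD _ _ Kk Kk')) _.
  by rewrite addrACA ler_normD.
rewrite le_eqVlt => /predU1P[<-|t0].
  by rewrite scale0r mul0r (le_trans (le_dist _ _ K0))// addr0 normr0.
rewrite mulrC -ler_pdivrMr//; apply: (dist_ge) => k Kk; rewrite ler_pdivrMr//.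
apply: le_trans (le_dist _ _ (KZ t _ Kk)) _.
by rewrite -scalerDr normrZ gtr0_norm// mulrC.
Qed.

Section fortin.
Variables (R : realType) (V L : normedModType R).
Variable b : {bilinear L -> V -> R | *%R & *%R}.

Lemma bilinear_linear_onl (B : set L) v : linear_on B (b^~ v : L -> R^o).
Proof. by move=> c x y _ _; rewrite linearPl. Qed.

Lemma bilinear_linear_onr (A : set V) l : linear_on A (b l : V -> R^o).
Proof. by move=> c x y _ _; rewrite linearPr. Qed.

(** Some [w0] in [A] has the right pairings with [B]; only its size must be reduced, by shifts in
    the kernel [K]. Hahn-Banach gives a functional [q] below the distance to [K] and equal to it at
    [w0]. Vanishing on [K], it has the form [b m], and the inf-sup condition yields |m| <= C. So the
    distance is b m w0 = b m z, at most Cb C |z|. *)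
Lemma fortin (A : set V) (B : set L) (Cb C : R) :
  findim_subspace A -> findim_subspace B -> 0 <= Cb -> 0 <= C ->
  (forall l v, b l v <= Cb * `|l| * `|v|) ->
  (forall m, B m -> `|m| <= C * sup_quotient b A m) ->
  forall z, exists w, [/\ A w, forall m, B m -> b m w = b m z &
    `|w| <= (Cb * C + 1) * `|z|].
Proof.
move=> fA fB Cb0 C0 b_cont infsup z.
have A0 := findim_subspace0 fA.
have [->|z0] := eqVneq z 0; first by exists 0; rewrite normr0 mulr0.
(* Solvability: an [m] in [B] that annihilates [A] has zero quotient supremum, so it is 0 by the
   inf-sup condition. *)
have [w0 Aw0 bw0] : exists2 w, A w & forall m, B m -> b m w = b m z.
  apply: (findim_solve (c := fun v m => b m v) fA fB) => [m _|v _||m Bm bm0].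
  - exact: bilinear_linear_onr.
  - exact: bilinear_linear_onl.
  - exact: bilinear_linear_onl.
  suff -> : m = 0 by rewrite linear0l.
  apply/eqP; rewrite -normr_le0 (le_trans (infsup _ Bm))//.
  rewrite -(mulr0 C) ler_wpM2l// sup_quotient_le// => v /bm0 ->.
  by rewrite mul0r.
pose K := [set k | A k /\ forall m, B m -> b m k = 0].
pose p v := inf [set `|v + k| | k in K].
have K0 : K 0 by split=> // m _; rewrite linear0r.
have sp : sublinear p.
  apply: dist_subspace_sublinear => // [x y [Ax bx] [Ay by_]|c x [Ax bx]].
    split=> [|m Bm]; first exact: findim_subspaceD.
    by rewrite linearDr bx// by_// addr0.
  split=> [|m Bm]; first exact: findim_subspaceZ.
  by rewrite linearZr bx//= mulr0.
have p_le v k : K k -> p v <= `|v + k|.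
  by move=> Kk; apply: ge_inf; [exists 0 => _ [? _ <-]|exists k].
have [q [ql qp qw0]] := hahn_banach_findim sp fA Aw0.
have [m Bm bm] : exists2 m, B m & forall v, A v -> b m v = q v.
  apply: (findim_solve fB fA) => // [v _|l _|v Av bv].
  - exact: bilinear_linear_onl.
  - exact: bilinear_linear_onr.
  (* On [K] the distance is 0, so [q] is nonpositive on a whole line and therefore zero on it. *)
  have q_le0 c : q (c *: v) <= 0.
    have Acv := findim_subspaceZ c fA Av.
    apply: le_trans (qp _ Acv) _; have := p_le (c *: v) (- (c *: v)).
    rewrite subrr normr0; apply; split=> [|m Bm]; first exact: findim_subspaceN.
    by rewrite linearNr linearZr bv//= mulr0 oppr0.
  have := q_le0 1; have := q_le0 (-1).
  by rewrite scaleN1r scale1r (linear_onN fA ql Av); lra.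
have m1 : `|m| <= C.
  apply: le_trans (infsup _ Bm) _; rewrite -[leRHS]mulr1 ler_wpM2l//.
  apply: sup_quotient_le => // v Av; rewrite mul1r bm//.
  by apply: le_trans (qp _ Av) _; rewrite -[v in leRHS]addr0 p_le.
(* The extra 1 in the constant, with [z] nonzero, makes the bound strict, so a near-minimiser in [K]
   satisfies it. *)
have pw0 : p w0 < (Cb * C + 1) * `|z|.
  rewrite -qw0 -bm// bw0// (le_lt_trans (b_cont _ _))//.
  rewrite ltr_pM2r ?normr_gt0//.
  by rewrite (@le_lt_trans _ _ (Cb * C))// ?ler_wpM2l// ltrDl.
have [|_ [k [Ak bk] <-] wk] := inf_lt _ pw0.
  by exists `|w0 + 0|, 0.
exists (w0 + k); split; [exact: findim_subspaceD| |exact: ltW].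
by move=> l Bl; rewrite linearDr bk// addr0 bw0.
Qed.

End fortin.

(** * Cauchy-Schwarz for the stabilisation form *)

Section stabilisation.
Variables (R : realType) (L : lmodType R) (B : set L) (s : L -> L -> R).
Hypotheses (fB : findim_subspace B) (s_sym : symmetric_bilinear_on B s).

Lemma symmetric_bilinear_onl y : B y -> linear_on B (s^~ y : L -> R^o).
Proof.
move=> By c x z Bx Bz; have [sl sC] := s_sym.
by rewrite sC//; [rewrite sl// !(sC y)|exact: findim_subspaceP].
Qed.

Hypothesis s_ge0 : forall x, B x -> 0 <= s x x.

Lemma symmetric_bilinear_on_quad t r x y : B x -> B y ->
  s (t *: x + r *: y) (t *: x + r *: y) =
  t ^+ 2 * s x x + 2 * (t * r) * s x y + r ^+ 2 * s y y.
Proof.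
move=> Bx By; have [sl sC] := s_sym.
have Bt := findim_subspaceZ t fB Bx; have Br := findim_subspaceZ r fB By.
have BD := findim_subspaceD fB Bt Br.
rewrite (linear_onD (sl _ BD))// !(linear_onZ fB (sl _ BD))//.
rewrite !(linear_onD (symmetric_bilinear_onl _))//.
rewrite !(linear_onZ fB (symmetric_bilinear_onl _))// (sC y x)//; ring.
Qed.

Lemma symmetric_bilinear_on_cs x y : B x -> B y ->
  s x y <= Num.sqrt (s x x) * Num.sqrt (s y y).
Proof.
move=> Bx By; set p := Num.sqrt (s x x); set q := Num.sqrt (s y y).
have p2 : s x x = p ^+ 2 by rewrite sqr_sqrtr// s_ge0.
have q2 : s y y = q ^+ 2 by rewrite sqr_sqrtr// s_ge0.
have p0 : 0 <= p by exact: sqrtr_ge0.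
have q0 : 0 <= q by exact: sqrtr_ge0.
have quad t r : 0 <= t ^+ 2 * p ^+ 2 + 2 * (t * r) * s x y + r ^+ 2 * q ^+ 2.
  rewrite -p2 -q2 -symmetric_bilinear_on_quad//; apply: s_ge0.
  by apply: findim_subspaceD => //; exact: findim_subspaceZ.
rewrite leNgt; apply/negP => pq.
have sxy0 : 0 < s x y by rewrite (le_lt_trans _ pq)// mulr_ge0.
(* The first choice gives the inequality when [p] and [q] are nonzero. The second and third give a
   contradiction when p = 0 and when q = 0 respectively, where [s x y] would be positive. *)
have := quad q (- p); have := quad (- (q ^+ 2 + 1)) (s x y).
have := quad (s x y) (- (p ^+ 2 + 1)).
have [->|p_neq0] := eqVneq p 0; first by move=> h1 h2 h3; nra.
have [->|q_neq0] := eqVneq q 0; first by move=> h1 h2 h3; nra.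
have pq0 : 0 < p * q by rewrite mulr_gt0// lt0r ?p_neq0 ?q_neq0.
by move=> _ _; nra.
Qed.

End stabilisation.

Lemma symmetric_bilinear_on_stab (R : realType) (L : lmodType R) (B : set L)
    (s : L -> L -> R) g :
  symmetric_bilinear_on B s -> symmetric_bilinear_on B (stab g s).
Proof.
move=> [sl sC]; split=> [x Bx c y z By Bz|x y Bx By]; last by rewrite /stab sC.
by rewrite /stab sl// /GRing.scale/=; ring.
Qed.

(** * Stability, well-posedness and best approximation on a fixed mesh *)

Section discrete_problem.
Variables (R : realType) (V L : normedModType R).
Variables (b : {bilinear L -> V -> R | *%R & *%R}).
Variables (Vh : set V) (Lh Lamh : set L) (s : L -> L -> R) (piL : L -> L).
Hypotheses (fV : findim_subspace Vh) (fL : findim_subspace Lamh).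
Hypothesis s_sym : symmetric_bilinear_on Lamh s.
Hypothesis s_ge0 : forall l, Lamh l -> 0 <= s l l.
Variables (Ca Cb Cinf Cinfh D Cv alpha c : R).
Hypotheses (Ca_ge0 : 0 <= Ca) (Cb_ge0 : 0 <= Cb) (Cinf_ge0 : 0 <= Cinf).
Hypotheses (Cinfh_ge0 : 0 <= Cinfh) (D_ge0 : 0 <= D) (Cv_ge0 : 0 <= Cv).
Hypotheses (alpha_gt0 : 0 < alpha) (c_ge0 : 0 <= c) (c_small : c ^+ 2 <= alpha).
Hypothesis b_infsup : forall l, `|l| <= Cinf * sup_quotient b setT l.
Hypothesis bh_infsup : forall m, Lh m -> `|m| <= Cinfh * sup_quotient b Vh m.
Hypothesis piL_Lh : forall l, Lamh l -> Lh (piL l).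
Hypothesis b_piL : forall l v, Lamh l ->
  b (l - piL l) v <= D * Num.sqrt (s l l) * `|v|.

Lemma multiplier_le l t : Lamh l -> 0 <= t ->
  (forall v, Vh v -> b l v <= t * `|v|) ->
  `|l| <= Cinfh * t + (Cinf + Cinfh) * D * Num.sqrt (s l l).
Proof.
move=> Bl t0 blt; set S := Num.sqrt (s l l).
have DS0 : 0 <= D * S by rewrite mulr_ge0// sqrtr_ge0.
have h1 : `|l - piL l| <= Cinf * (D * S).
  apply: le_trans (b_infsup _) _; rewrite ler_wpM2l//.
  by apply: sup_quotient_le => // v _; exact: b_piL.
have h2 : `|piL l| <= Cinfh * (t + D * S).
  apply: le_trans (bh_infsup (piL_Lh Bl)) _; rewrite ler_wpM2l//.
  apply: sup_quotient_le => [|v Av]; first exact: addr_ge0.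
  (* b (piL l) v = b l v - b (l - piL l) v; as [b_piL] is one-sided, the minus sign is moved onto
     [v]. *)
  rewrite -[piL l](subKr l) linearBl mulrDl lerD ?blt//.
  by rewrite -linearNr -(normrN v) b_piL.
by have := ler_normD (l - piL l) (piL l); rewrite subrK; lra.
Qed.

Variable normVh : V -> R.
Hypothesis normVh_ge0 : forall v, Vh v -> 0 <= normVh v.
Hypothesis normV_le : forall v, Vh v -> `|v| <= Cv * normVh v.

(** This is 2 M with M = 1 + Q (1 + 1/alpha) and Q = (Cv + c)^2 / alpha + 1. Since [M] dominates 1,
    Q and Q/alpha, its square dominates the last two as well, so one constant serves for [E] and [S]
    and no root appears. *)
Definition energy_const : R :=
  2 * (1 + ((Cv + c) ^+ 2 / alpha + 1) * (1 + alpha^-1)).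

Lemma energy_const_ge0 : 0 <= energy_const.
Proof.
by rewrite mulr_ge0// addr_ge0// mulr_ge0// addr_ge0// ?divr_ge0 ?exprn_ge0//
  ?addr_ge0// ?invr_ge0 ltW.
Qed.

(** Young's inequality: c^2 <= alpha lets half of the left side absorb the cross term [c * E * S],
    and another quarter absorbs the terms linear in [E] and [S], at the cost of Q d^2. *)
Lemma energy_le E S d : 0 <= E -> 0 <= S -> 0 <= d ->
  alpha * E ^+ 2 + S ^+ 2 <= c * E * S + d * ((Cv + c) * E + S) ->
  E <= energy_const * d /\ S <= energy_const * d.
Proof.
move=> E0 S0 d0; rewrite /energy_const; set k := Cv + c => H.
set Q := k ^+ 2 / alpha + 1.
have kQ : k ^+ 2 = alpha * (Q - 1) by rewrite addrK mulrC divfK// gt_eqF.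
have Q1 : 1 <= Q by rewrite lerDr divr_ge0// ?sqr_ge0// ltW.
have key : alpha * E ^+ 2 + S ^+ 2 <= 4 * Q * d ^+ 2.
  have h1 : c * E * S <= alpha / 2 * E ^+ 2 + S ^+ 2 / 2.
    have := sqr_ge0 (c * E - S).
    have := ler_wpM2r (sqr_ge0 E) c_small; nra.
  have h2 : d * (k * E) <= alpha / 4 * E ^+ 2 + (Q - 1) * d ^+ 2.
    (* After multiplication by [alpha] the difference is a perfect square, by [kQ]. *)
    rewrite -subr_ge0 -(pmulr_rge0 _ alpha_gt0).
    have -> : alpha * (alpha / 4 * E ^+ 2 + (Q - 1) * d ^+ 2 - d * (k * E)) =
      (alpha * E / 2 - k * d) ^+ 2.
      transitivity (alpha ^+ 2 * E ^+ 2 / 4 - alpha * d * (k * E) +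
        k ^+ 2 * d ^+ 2); last by field.
      by rewrite kQ; field.
    exact: sqr_ge0.
  have h3 : d * S <= S ^+ 2 / 4 + d ^+ 2.
    by have := sqr_ge0 (S / 2 - d); nra.
  by nra.
have ai0 : 0 < alpha^-1 by rewrite invr_gt0.
have aai : alpha * alpha^-1 = 1 by rewrite divff// gt_eqF.
set M := 1 + Q * (1 + alpha^-1).
have Qai : 0 <= Q * alpha^-1 by rewrite mulr_ge0 ?(ltW ai0)//; lra.
have M1 : 1 <= M by rewrite lerDl mulrDr mulr1; lra.
have MM : M <= M ^+ 2 by rewrite expr2 ler_peMl//; lra.
have MQ : Q <= M by rewrite /M mulrDr mulr1; lra.
have MQa : Q * alpha^-1 <= M by rewrite /M mulrDr mulr1; lra.
have Md0 : 0 <= 2 * M * d by rewrite !mulr_ge0//; lra.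
have d2 := sqr_ge0 d.
split; rewrite -ler_sqr ?nnegrE// !exprMn.
  have E2 : E ^+ 2 <= 4 * (Q * alpha^-1) * d ^+ 2.
    rewrite -(ler_pM2l alpha_gt0).
    have -> : alpha * (4 * (Q * alpha^-1) * d ^+ 2) = 4 * Q * d ^+ 2.
      transitivity (4 * Q * (alpha * alpha^-1) * d ^+ 2); first by ring.
      by rewrite aai mulr1.
    by have := sqr_ge0 S; lra.
  apply: le_trans E2 _; rewrite ler_wpM2r//.
  by rewrite (_ : 2 ^+ 2 = 4); [lra|ring].
have S2 : S ^+ 2 <= 4 * Q * d ^+ 2.
  by have := mulr_ge0 (ltW alpha_gt0) (sqr_ge0 E); lra.
apply: le_trans S2 _; rewrite ler_wpM2r//.
by rewrite (_ : 2 ^+ 2 = 4); [lra|ring].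
Qed.

(** The first summand bounds |e|; the others come from [multiplier_le] with t = d + Ca |e|. *)
Definition stability_const : R :=
  Cv * energy_const + Cinfh * (1 + Ca * (Cv * energy_const)) +
  (Cinf + Cinfh) * D * energy_const.

Lemma stability_const_ge0 : 0 <= stability_const.
Proof.
have := energy_const_ge0 => E0.
have CE0 : 0 <= Cv * energy_const by exact: mulr_ge0.
apply: addr_ge0; first by rewrite addr_ge0// mulr_ge0// addr_ge0// mulr_ge0.
by rewrite mulr_ge0// mulr_ge0// addr_ge0.
Qed.

(* The form [a] enters only through its boundedness and the coercivity
   condition, both insensitive to transposition: the estimate also covers the
   adjoint problem. *)
Lemma stability (a : V -> V -> R) e l d :
  (forall u v, `|a u v| <= Ca * `|u| * `|v|) ->
  (forall u, Vh u -> exists xi, [/\ Lamh xi,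
     alpha * normVh u ^+ 2 <= a u u + b xi u &
     Num.sqrt (s xi xi) <= c * normVh u]) ->
  Vh e -> Lamh l -> 0 <= d ->
  (forall v, Vh v -> a e v + b l v <= d * `|v|) ->
  (forall m, Lamh m -> b m e - s l m <= d * Num.sqrt (s m m)) ->
  `|e| + `|l| <= stability_const * d.
Proof.
move=> a_cont xi_cond Ve Ll d0 testV testL.
have [sl sC] := s_sym.
have [xi [Lxi xi1 xi2]] := xi_cond _ Ve.
set E := normVh e in xi1 xi2; set S := Num.sqrt (s l l).
have E0 : 0 <= E by exact: normVh_ge0.
have S0 : 0 <= S by exact: sqrtr_ge0.
have S2 : S ^+ 2 = s l l by rewrite sqr_sqrtr// s_ge0.
have Lml := findim_subspaceN fL Ll.
(* The tests v = e, m = - l and m = xi are added: [b l e] cancels, and a e e + b xi e + s l l - s l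
   xi remains. The bounds on |e| and on xi produce the factor [Cv + c]. *)
have h1 := testV _ Ve.
have h2 : - b l e + s l l <= d * S.
  have := testL _ Lml.
  by rewrite (linear_onN fL (sl _ Lml))// (sC _ l)// (linear_onN fL (sl _ Ll))//
    !opprK linearNl.
have h3 := testL _ Lxi.
have h4 := symmetric_bilinear_on_cs fL s_sym s_ge0 Ll Lxi.
have h5 : s l xi <= c * E * S.
  by apply: le_trans h4 _; rewrite mulrC ler_wpM2r.
have h6 : d * Num.sqrt (s xi xi) <= d * (c * E) by rewrite ler_wpM2l.
have h7 : d * `|e| <= d * (Cv * E) by rewrite ler_wpM2l// normV_le.
have [E_le S_le] : E <= energy_const * d /\ S <= energy_const * d.
  by apply: energy_le => //; rewrite S2; lra.
have e_le : `|e| <= Cv * energy_const * d.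
  by apply: le_trans (normV_le Ve) _; rewrite -mulrA ler_wpM2l.
have l_le : `|l| <= Cinfh * (d + Ca * `|e|) + (Cinf + Cinfh) * D * S.
  apply: multiplier_le => // [|v Vv]; first by rewrite addr_ge0// mulr_ge0.
  have := testV _ Vv; have := a_cont e v; rewrite ler_norml => /andP[]; lra.
have h8 : Cinfh * (Ca * `|e|) <= Cinfh * (Ca * (Cv * energy_const * d)).
  by rewrite !ler_wpM2l.
have h9 : (Cinf + Cinfh) * D * S <= (Cinf + Cinfh) * D * (energy_const * d).
  by rewrite ler_wpM2l// mulr_ge0// addr_ge0.
by rewrite /stability_const; lra.
Qed.

Variable a : {biscalar V}.
Hypothesis a_cont : forall u v, `|a u v| <= Ca * `|u| * `|v|.
Hypothesis b_cont : forall l v, b l v <= Cb * `|l| * `|v|.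
Hypothesis xi_cond : forall u, Vh u -> exists xi, [/\ Lamh xi,
  alpha * normVh u ^+ 2 <= a u u + b xi u &
  Num.sqrt (s xi xi) <= c * normVh u].

(** Stability with d = 0. A separate [a'] with the diagonal of [a] lets it serve both [a]
    (uniqueness) and its transpose (existence). *)
Lemma homogeneous_eq0 (a' : V -> V -> R) e l :
  (forall u v, `|a' u v| <= Ca * `|u| * `|v|) ->
  (forall u, a' u u = a u u) -> Vh e -> Lamh l ->
  (forall v, Vh v -> a' e v + b l v = 0) ->
  (forall m, Lamh m -> b m e - s l m = 0) -> e = 0 /\ l = 0.
Proof.
move=> a'_cont a'E Ve Ll testV testL.
have : `|e| + `|l| <= stability_const * 0.
  apply: (@stability a') => // [u /xi_cond|v /testV ->|m /testL ->];
    by rewrite ?mul0r ?a'E.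
rewrite mulr0 => h; have := normr_ge0 e; have := normr_ge0 l => h1 h2.
by split; apply/eqP; rewrite -normr_eq0; apply/eqP; lra.
Qed.

Lemma stabilised_solutionP (f : {scalar V}) (p : V * L) :
  stabilised_solution a b f Vh Lamh s p <->
  [/\ Vh p.1, Lamh p.2, forall v, Vh v -> a p.1 v + b p.2 v = f v &
      forall m, Lamh m -> b m p.1 - s p.2 m = 0].
Proof.
have [sl _] := s_sym.
split=> [[Vp Lp sol]|[Vp Lp sol1 sol2]]; last first.
  by split=> // v m Vv Lm; rewrite -addrA sol2// addr0 sol1.
split=> // [v Vv|m Lm].
- have := sol v 0 Vv (findim_subspace0 fL).
  by rewrite linear0l (linear_on0 fL (sl _ Lp)) subr0 addr0.
- have := sol 0 m (findim_subspace0 fV) Lm.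
  by rewrite !linear0r linear0 !add0r.
Qed.

(** By [findim_solve], existence reduces to the triviality of the adjoint kernel; [b] and [s] enter
    the block form symmetrically, so the adjoint problem only transposes [a]. *)
Lemma stabilised_solution_exists_unique (f : {scalar V}) :
  exists! p, stabilised_solution a b f Vh Lamh s p.
Proof.
have [sl sC] := s_sym.
pose F (q r : V * L) := a q.1 r.1 + b q.2 r.1 + b r.2 q.1 - s q.2 r.2.
have [p [Vp Lp] Fp] : exists2 p, (Vh `*` Lamh) p &
    forall r, (Vh `*` Lamh) r -> F p r = f r.1.
  apply: (findim_solve (findim_subspaceX fV fL) (findim_subspaceX fV fL)).
  - move=> r [Vr Lr] t x y [Vx Lx] [Vy Ly]; rewrite /F/=.
    rewrite !linearPl linearPr (symmetric_bilinear_onl fL s_sym Lr)//=.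
    by rewrite /GRing.scale/=; ring.
  - move=> r [Vr Lr] t x y [Vx Lx] [Vy Ly]; rewrite /F/=.
    by rewrite !linearPr linearPl sl//= /GRing.scale/=; ring.
  - by move=> t x y _ _; rewrite /= linearP.
  - move=> [v m] [/= Vv Lm] ann.
    have [-> _] : v = 0 /\ m = 0; last by rewrite linear0.
    apply: (@homogeneous_eq0 (fun x y => a y x)) => // [x y|x Vx|k Lk].
    + by rewrite mulrAC a_cont.
    + have := ann (x, 0) (conj Vx (findim_subspace0 fL)).
      rewrite /F/= linear0l addr0.
      by rewrite (linear_on0 fL (symmetric_bilinear_onl fL s_sym Lm)) subr0.
    + have := ann (0, k) (conj (findim_subspace0 fV) Lk).
      by rewrite /F/= linear0l !linear0r add0r addr0 sC.
exists p; split; first by split=> // v m Vv Lm; exact: (Fp (v, m)).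
move=> [u l] /stabilised_solutionP[/= Vu Ll sol1 sol2].
have /stabilised_solutionP[_ _ sol1' sol2'] :
    stabilised_solution a b f Vh Lamh s p.
  by split=> // v m Vv Lm; exact: (Fp (v, m)).
have [e0 l0] : p.1 - u = 0 /\ p.2 - l = 0.
  apply: (@homogeneous_eq0 a) => // [| |v Vv|m Lm].
  - exact: findim_subspaceB.
  - exact: findim_subspaceB.
  - by have := sol1 _ Vv; have := sol1' _ Vv; rewrite !linearBl; lra.
  - have := sol2 _ Lm; have := sol2' _ Lm.
    rewrite linearBr (linear_onB fL (symmetric_bilinear_onl fL s_sym Lm))//.
    lra.
by rewrite [p]surjective_pairing; congr pair; apply/eqP;
  rewrite -subr_eq0 ?e0 ?l0.
Qed.

Hypothesis fLh : findim_subspace Lh.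

(** With K = Cb Cinfh + 1 from [fortin], this is K + 2, from the triangle inequalities, plus the
    stability constant times the factor bounding the residuals of the discrete error. *)
Definition approx_const : R :=
  Cb * Cinfh + 3 +
  stability_const * ((Ca + D) * (Cb * Cinfh + 2) + Cb + 1).

(* Correcting [y] by [fortin] makes [u - y] invisible to [Lh]: its pairing with
   any multiplier is then controlled by the stabilisation. *)
Lemma best_approximation (f : {scalar V}) (u uh y : V) (l lh n : L) :
  continuous_solution a b f (u, l) ->
  stabilised_solution a b f Vh Lamh s (uh, lh) -> Vh y -> Lamh n ->
  `|u - uh| + `|l - lh| <=
    approx_const * (`|u - y| + (`|l - n| + Num.sqrt (s n n))).
Proof.
move=> sol /stabilised_solutionP[/= Vuh Llh sol1 sol2] Vy Ln.
have [sl sC] := s_sym.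
have [w [Vw bw w_le]] :=
  fortin fV fLh Cb_ge0 Cinfh_ge0 b_cont bh_infsup (u - y).
set K := Cb * Cinfh + 1 in w_le.
have K1 : 1 <= K by rewrite lerDr mulr_ge0.
set S := Num.sqrt (s n n); have S0 : 0 <= S by exact: sqrtr_ge0.
set X := `|u - y| in w_le *; set Y := `|l - n|.
have X0 : 0 <= X by exact: normr_ge0. have Y0 : 0 <= Y by exact: normr_ge0.
set z := u - (y + w).
have z_le : `|z| <= (K + 1) * X.
  rewrite /z opprD addrA; apply: le_trans (ler_normB _ _) _; rewrite -/X; lra.
have Vyw := findim_subspaceD fV Vy Vw.
set d := ((Ca + D) * (K + 1) + Cb + 1) * (X + (Y + S)).
have CK0 : 0 <= Ca * (K + 1) by rewrite mulr_ge0//; lra.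
have DK0 : 0 <= D * (K + 1) by rewrite mulr_ge0//; lra.
(* [d] is split into the terms that bound the residuals and a nonnegative remainder. *)
have dE : d = Ca * (K + 1) * X + D * (K + 1) * X + Cb * Y + S +
    (Ca * (K + 1) * (Y + S) + D * (K + 1) * (Y + S) + Cb * (X + S) + (X + Y)).
  by rewrite /d; ring.
have rest_ge0 : 0 <= Ca * (K + 1) * (Y + S) + D * (K + 1) * (Y + S) +
    Cb * (X + S) + (X + Y).
  by rewrite !addr_ge0// mulr_ge0// addr_ge0.
have CX0 : 0 <= Ca * (K + 1) * X by exact: mulr_ge0.
have DX0 : 0 <= D * (K + 1) * X by exact: mulr_ge0.
have BY0 : 0 <= Cb * Y by exact: mulr_ge0.
have dE1 : Ca * `|z| + Cb * Y <= d.
  have h1 : Ca * `|z| <= Ca * (K + 1) * X by rewrite -mulrA ler_wpM2l.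
  by rewrite dE; lra.
have dE2 : D * `|z| + S <= d.
  have h1 : D * `|z| <= D * (K + 1) * X by rewrite -mulrA ler_wpM2l.
  by rewrite dE; lra.
have d0 : 0 <= d by rewrite (le_trans _ dE2)// addr_ge0// mulr_ge0.
have : `|uh - (y + w)| + `|lh - n| <= stability_const * d.
  apply: (@stability a) => // [||v Vv|m Lm].
  - exact: findim_subspaceB.
  - exact: findim_subspaceB.
  (* Galerkin orthogonality: both problems are tested with [v] and multiplier 0. *)
  - have -> : a (uh - (y + w)) v + b (lh - n) v = a z v + b (l - n) v.
      have := sol v 0; have := sol1 _ Vv.
      by rewrite /z /= linear0l !linearBl; lra.
    rewrite (le_trans _ (ler_wpM2r (normr_ge0 v) dE1))// mulrDl lerD//.
    by rewrite (le_trans (ler_norm _)).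
  (* Here b m u = 0 and b m uh = s lh m, while b (piL m) z = 0 by the choice of [w]; so [z] meets
     only [m - piL m], which [s] controls. *)
  - have -> : b m (uh - (y + w)) - s (lh - n) m = b (m - piL m) z + s n m.
      have := sol 0 m; have := sol2 _ Lm; have := bw _ (piL_Lh Lm).
      rewrite /z /= !linear0r linear0.
      rewrite (linear_onB fL (symmetric_bilinear_onl fL s_sym Lm))//.
      by rewrite !(linearBr, linearDr, linearBl); lra.
    have h1 := symmetric_bilinear_on_cs fL s_sym s_ge0 Ln Lm.
    have h2 := b_piL z Lm.
    have := ler_wpM2r (sqrtr_ge0 (s m m)) dE2; rewrite mulrDl -/S in h1 *.
    by lra.
have h1 : `|u - uh| <= `|z| + `|uh - (y + w)|.
  by rewrite -[u - uh](subrKA (y + w)) -/z (distrC uh) ler_normD.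
have h2 : `|l - lh| <= Y + `|lh - n|.
  by rewrite -[l - lh](subrKA n) (distrC lh) ler_normD.
have -> : approx_const * (X + (Y + S)) =
   (K + 2) * (X + (Y + S)) + stability_const * d.
  by rewrite /approx_const /d /K; ring.
have h3 : 0 <= (K + 2) * S by rewrite mulr_ge0//; lra.
have h4 : 0 <= (K + 1) * Y by rewrite mulr_ge0//; lra.
by lra.
Qed.

End discrete_problem.

(** * Choice of the stabilisation parameter and uniformity in the mesh *)

Lemma approx_const_gt0 (R : realType) (Ca Cb Cinf Cinfh D Cv alpha c : R) :
  0 <= Ca -> 0 <= Cb -> 0 <= Cinf -> 0 <= Cinfh -> 0 <= D -> 0 <= Cv ->
  0 < alpha -> 0 <= c -> 0 < approx_const Ca Cb Cinf Cinfh D Cv alpha c.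
Proof.
move=> Ca0 Cb0 Ci0 Ch0 D0 Cv0 al0 c0.
have BH0 : 0 <= Cb * Cinfh by exact: mulr_ge0.
apply: ltr_wpDr; last by lra.
apply: mulr_ge0; first exact: stability_const_ge0.
by rewrite !addr_ge0// mulr_ge0// addr_ge0.
Qed.

Lemma right_limit0_small (R : realType) (c : R -> R) (e : R) :
  0 < e -> c g @[g --> 0^'+] --> (0 : R) ->
  exists2 g0, 0 < g0 & forall g, 0 < g <= g0 -> `|c g| < e.
Proof.
move=> e0 /cvgrPdist_lt/(_ _ e0)[r /= r0 rP].
(* Halving fits the closed bound g <= g0 into the open ball of radius [r]. *)
exists (r / 2) => [|g /andP[g0 gr]]; first by rewrite divr_gt0.
rewrite -normrN -sub0r; apply: rP => //.
by rewrite /= sub0r normrN gtr0_norm//; lra.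
Qed.
Theorem theorem2p1 (R : realType) (V L : normedModType R)
  (* continuous forms *)
  (a : {biscalar V}) (b : {bilinear L -> V -> R | *%R & *%R})
  (a_cont : exists2 C : R, 0 < C & forall u v : V, a u v <= C * `|u| * `|v|)
  (b_cont : exists2 C : R, 0 < C &
     forall (l : L) (v : V), b l v <= C * `|l| * `|v|)
  (a_coercive : exists2 C : R, 0 < C &
     forall v : V, (forall m : L, b m v = 0) -> `|v| ^+ 2 <= C * a v v)
  (b_infsup : exists2 C : R, 0 < C &
     forall l : L, `|l| <= C * sup_quotient b setT l)
  (* family of meshes, discrete spaces and their norms *)
  (mesh : Type) (Vh : mesh -> set V) (Lh Lamh : mesh -> set L)
  (Vh_sub : forall h, findim_subspace (Vh h))
  (Lh_sub : forall h, findim_subspace (Lh h))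
  (Lamh_sub : forall h, findim_subspace (Lamh h))
  (normVh : mesh -> V -> R) (normLh : mesh -> L -> R)
  (normVh_norm : forall h, norm_on (Vh h) (normVh h))
  (normLh_norm : forall h,
     norm_on [set x + y | x in Lamh h & y in Lh h] (normLh h))
  (a_bound : forall h u v, Vh h u -> Vh h v ->
     a u v <= normVh h u * normVh h v)
  (b_bound : forall h l v, Lh h l -> Vh h v ->
     b l v <= normLh h l * normVh h v)
  (normV_le : exists2 C : R, 0 < C &
     forall h v, Vh h v -> `|v| <= C * normVh h v)
  (* projection *)
  (piL : mesh -> L -> L)
  (piL_proj : forall h, projection_onto (Lamh h) (Lh h) (piL h))
  (piL_bound : exists2 C : R, 0 < C &
     forall h l (v : V), Lamh h l ->
       b (l - piL h l) v <= C * normLh h (l - piL h l) * `|v|)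
  (* stabilisation, [stab g (s h)] for the stabilisation parameter g > 0 *)
  (s : mesh -> L -> L -> R)
  (s_sym : forall h, symmetric_bilinear_on (Lamh h) (s h))
  (s_design : forall g : R, 0 < g -> exists2 C : R, 0 < C &
     forall h l, Lamh h l ->
       normLh h (l - piL h l) ^+ 2 <= C * stab g (s h) l l)
  (* (i) *)
  (alpha_xi : R) (alpha_xi_gt0 : 0 < alpha_xi)
  (c_s : R -> R) (c_s_gt0 : forall g, 0 < g -> 0 < c_s g)
  (c_s_small : c_s g @[g --> 0^'+] --> (0 : R))
  (xi_cond : forall g : R, 0 < g -> forall h u, Vh h u ->
     exists xi, [/\ Lamh h xi,
       alpha_xi * normVh h u ^+ 2 <= a u u + b xi u &
       Num.sqrt (stab g (s h) xi xi) <= c_s g * normVh h u])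
  (* (ii) *)
  (bh_infsup : exists2 C : R, 0 < C &
     forall h m, Lh h m -> `|m| <= C * sup_quotient b (Vh h) m) :
  exists2 g0 : R, 0 < g0 &
  forall g : R, 0 < g <= g0 ->
  exists2 C : R, 0 < C &
  forall f : {scalar V},
    (exists! q : V * L, continuous_solution a b f q) ->
  forall h : mesh,
    (exists! p : V * L,
       stabilised_solution a b f (Vh h) (Lamh h) (stab g (s h)) p) /\
    forall (uh u : V) (lh l : L),
      stabilised_solution a b f (Vh h) (Lamh h) (stab g (s h)) (uh, lh) ->
      continuous_solution a b f (u, l) ->
      `|u - uh| + `|l - lh| <=
      C * (inf [set `|u - y| | y in Vh h] +
           inf [set `|l - n| + Num.sqrt (stab g (s h) n n) | n in Lamh h]).
Proof.
have [Ca Ca0 a_le] := a_cont; have [Cb Cb0 b_le] := b_cont.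
have [Cinf Cinf0 b_is] := b_infsup; have [Cinfh Cinfh0 bh_is] := bh_infsup.
have [Cv Cv0 nV] := normV_le; have [Cp Cp0 b_pi] := piL_bound.
have a_abs u v : `|a u v| <= Ca * `|u| * `|v|.
  rewrite ler_norml a_le andbT lerNl -(normrN v).
  by rewrite -linearNr a_le.
(* This threshold ensures (c_s g)^2 <= alpha_xi, the smallness required by [energy_le]. *)
have [g0 g00 small] : exists2 g0, 0 < g0 &
    forall g, 0 < g <= g0 -> `|c_s g| < Num.sqrt alpha_xi.
  by apply: right_limit0_small => //; rewrite sqrtr_gt0.
exists g0 => // g gg0; have /andP[gpos _] := gg0.
have cs0 := ltW (c_s_gt0 _ gpos).
have cs2 : c_s g ^+ 2 <= alpha_xi.
  have cs_le : c_s g <= Num.sqrt alpha_xi.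
    exact: le_trans (ler_norm _) (ltW (small _ gg0)).
  by rewrite -(sqr_sqrtr (ltW alpha_xi_gt0)) !expr2 ler_pM.
have [Cs Cs0 s_le] := s_design _ gpos.
have piLh h m : Lamh h m -> Lh h (piL h m) by have [_ + _] := piL_proj h; exact.
have normLh_ge0 h m : Lamh h m -> 0 <= normLh h (m - piL h m).
  move=> Lm; have [+ _ _ _] := normLh_norm h; apply; exists m => //.
  by exists (- piL h m) => //; apply: findim_subspaceN (piLh _ _ Lm).
(* Positivity of the stabilisation follows from the design condition, whose left side is a
   square. *)
have s_ge0 h m : Lamh h m -> 0 <= stab g (s h) m m.
  move=> Lm; have := s_le h m Lm; rewrite -(pmulr_rge0 _ Cs0).
  by apply: le_trans; exact: sqr_ge0.
have b_pi' h m v : Lamh h m ->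
    b (m - piL h m) v <= Cp * Num.sqrt Cs * Num.sqrt (stab g (s h) m m) * `|v|.
  move=> Lm; apply: le_trans (b_pi h m v Lm) _; rewrite ler_wpM2r//.
  rewrite -mulrA ler_wpM2l ?(ltW Cp0)// -sqrtrM ?(ltW Cs0)//.
  by rewrite -[leLHS]ger0_norm ?normLh_ge0// -sqrtr_sqr ler_wsqrtr// s_le.
have D0 : 0 <= Cp * Num.sqrt Cs by rewrite mulr_ge0 ?sqrtr_ge0// ltW.
(* All the arguments are fixed before [h]; the parameter [g] enters through [Cs] and [c_s g]. *)
pose C := approx_const Ca Cb Cinf Cinfh (Cp * Num.sqrt Cs) Cv alpha_xi (c_s g).
have C0 : 0 < C by apply: approx_const_gt0 => //; exact: ltW.
exists C => // f _ h.
have ss := symmetric_bilinear_on_stab g (s_sym h).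
have nV0 v : Vh h v -> 0 <= normVh h v.
  by have [+ _ _ _] := normVh_norm h; exact.
split.
  exact: (stabilised_solution_exists_unique (Vh_sub h) (Lamh_sub h) ss
    (@s_ge0 h) (ltW Ca0) (ltW Cinf0) (ltW Cinfh0) D0 (ltW Cv0) alpha_xi_gt0
    cs2 b_is (@bh_is h) (@piLh h) (@b_pi' h) nV0 (@nV h) a_abs
    (xi_cond _ gpos h)).
move=> uh u lh l solh sol.
have main y n : Vh h y -> Lamh h n -> `|u - uh| + `|l - lh| <=
    C * (`|u - y| + (`|l - n| + Num.sqrt (stab g (s h) n n))).
  move=> Vy Ln.
  by apply: (best_approximation (Vh_sub h) (Lamh_sub h) ss
    (@s_ge0 h) (ltW Ca0) (ltW Cb0) (ltW Cinf0) (ltW Cinfh0) D0 (ltW Cv0)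
    alpha_xi_gt0 cs2 b_is (@bh_is h) (@piLh h) (@b_pi' h) nV0 (@nV h) a_abs
    b_le (xi_cond _ gpos h) (Lh_sub h) sol solh).
(* Dividing by C > 0 turns the claim into lower bounds for two infima, taken in turn over sets made
   nonempty by 0. *)
rewrite mulrC -ler_pdivrMr// -lerBlDr.
apply: lb_le_inf.
  by exists `|u - 0|, 0 => //; exact: findim_subspace0 (Vh_sub h).
move=> _ [y Vy <-]; rewrite lerBlDr -lerBlDl.
apply: lb_le_inf.
  exists (`|l - 0| + Num.sqrt (stab g (s h) 0 0)), 0 => //.
  exact: findim_subspace0 (Lamh_sub h).
by move=> _ [n Ln <-]; rewrite lerBlDl ler_pdivrMr// mulrC main.
Qed.
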